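(* For every purely hyperbolic pseudo-length $\lVert\cdot\rVert\colon F(a,b)\to\mathbb{R}_{+}$ on the free group $F(a,b)$ over $\{a,b\}$, Algorithm 1 (described in the context), given $\lVert\cdot\rVert$ as input, terminates after a finite number of steps and returns the correct output, i.e. a pair $(g,h)\in F(a,b)\times F(a,b)$ that is a ping-pong pair with respect to $\lVert\cdot\rVert$ and generates $F(a,b)$.
   Context: $\mathbb{R}_{+}:=\{\lambda\in\mathbb{R}:\lambda\ge0\}$. A function $\lVert\cdot\rVert\colon G\to\mathbb{R}_{+}$ on a group $G$ is a (real-valued) pseudo-length if: (A1) $\lVert ghg^{-1}\rVert=\lVert h\rVert$ for any $g,h\in G$; (A2) $\lVert gh\rVert=\lVert gh^{-1}\rVert$ or $\max\{\lVert gh\rVert,\lVert gh^{-1}\rVert\}\le\lVert g\rVert+\lVert h\rVert$, for any $g,h\in G$; (A3) $\lVert gh\rVert=\lVert gh^{-1}\rVert>\lVert g\rVert+\lVert h\rVert$ or $\max\{\lVert gh\rVert,\lVert gh^{-1}\rVert\}=\lVert g\rVert+\lVert h\rVert$, for any $g,h\in G$ with $\lVert g\rVert>0$, $\lVert h\rVert>0$. (For general ordered abelian groups $\Lambda$ there is an additional axiom (A0), $\max\{0,\lVert gh\rVert-\lVert g\rVert-\lVert h\rVert\}\in2\Lambda$ whenever $\lVert g\rVert,\lVert h\rVert>0$, which is vacuous for $\Lambda=\mathbb{R}$.) A pseudo-length is purely hyperbolic if $\lVert g\rVert>0$ for all $g\ne1$. A pair $(g,h)$ is a ping-pong pair if $\lVert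 g\rVert>0$, $\lVert h\rVert>0$, and $\bigl|\lVert g\rVert-\lVert h\rVert\bigr|<\min\{\lVert gh\rVert,\lVert gh^{-1}\rVert\}$. Algorithm 1. Input: a purely hyperbolic pseudo-length $\lVert\cdot\rVert\colon F(a,b)\to\mathbb{R}_{+}$. Let ''normalize'' denote the following two steps performed in order on the current pair $(g,h)$: if $\lVert g\rVert<\lVert h\rVert$, replace $(g,h)$ by $(h,g)$; then, if $\lVert gh\rVert<\lVert gh^{-1}\rVert$, replace $(g,h)$ by $(g,h^{-1})$. Step 1: set $(g,h):=(a,b)$ and normalize. Step 2: while $\lVert g\rVert-\lVert h\rVert=\lVert gh^{-1}\rVert$, replace $(g,h)$ by $(gh^{-1},h)$ and then normalize. Step 3: after leaving the loop, if $\lVert g\rVert-\lVert h\rVert<\lVert gh^{-1}\rVert$ return $(g,h)$; otherwise return $(gh^{-1},h)$. *)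

(* Defs.v *)
From HB Require Import structures.
From mathcomp Require Import all_boot all_order all_algebra.
From mathcomp Require Import boolp classical_sets reals.

Set Implicit Arguments.
Unset Strict Implicit.
Unset Printing Implicit Defensive.

Import Order.TTheory GRing.Theory Num.Theory.

Local Open Scope group_scope.

(* The free group on [T] is the group of reduced words; the letter [(x, false)]
   stands for [x] and [(x, true)] for its inverse. *)

Section FreeGroup.
Context {T : choiceType}.
Implicit Types (l m : T * bool) (s t r : seq (T * bool)).

Definition letter_inv l : T * bool := (l.1, ~~ l.2).

Definition reduced s : bool := sorted (fun l m => m != letter_inv l) s.

Definition push l s : seq (T * bool) :=
  if s is m :: s' then if m == letter_inv l then s' else l :: s else [:: l].

Definition reduce s : seq (T * bool) := foldr push [::] s.

Definition word_inv s : seq (T * bool) := rev [seq letter_inv l | l <- s].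

Lemma letter_invK : involutive letter_inv.
Proof. by case=> x e; rewrite /letter_inv /= negbK. Qed.

Lemma push_reduced l s : reduced s -> reduced (push l s).
Proof.
case: s => [//|m s] /= Hs; case: ifPn => [_|Hm]; first exact: path_sorted Hs.
by rewrite /reduced /= Hm.
Qed.

Lemma foldr_push_reduced s r : reduced r -> reduced (foldr push r s).
Proof. by move=> Hr; elim: s => //= l s; exact: push_reduced. Qed.

Lemma reduce_reduced s : reduced (reduce s).
Proof. exact: foldr_push_reduced. Qed.

Lemma reduce_id s : reduced s -> reduce s = s.
Proof.
elim: s => //= l s IHs Hs; rewrite (IHs (path_sorted Hs)).
by case: s Hs {IHs} => //= m s /andP[/negPf-> _].
Qed.

Lemma pushK l r : reduced r -> push l (push (letter_inv l) r) = r.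
Proof.
case: r => [|m r] /=; first by rewrite eqxx.
rewrite letter_invK; case: eqP => [-> Hr|_ _ /=]; last by rewrite eqxx.
by case: r Hr => //= m' r /andP[/negPf-> _].
Qed.

Lemma foldr_push_reduce s r :
  reduced r -> foldr push r (reduce s) = foldr push r s.
Proof.
move=> Hr; elim: s => //= l s <-; case: (reduce s) => //= m s'.
by case: eqP => //= ->; rewrite pushK ?foldr_push_reduced.
Qed.

Lemma foldr_push_inv s r :
  reduced r -> foldr push (foldr push r s) (word_inv s) = r.
Proof.
move=> Hr; rewrite /word_inv; elim: s => //= l s IHs.
rewrite rev_cons -cats1 foldr_cat /= -[X in push _ (push X _)]letter_invK.
by rewrite pushK ?foldr_push_reduced.
Qed.

Lemma word_invK : involutive word_inv.
Proof. by move=> s; rewrite /word_inv map_rev revK (mapK letter_invK). Qed.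

Lemma word_inv_reduced s : reduced s -> reduced (word_inv s).
Proof.
rewrite /reduced /word_inv rev_sorted sorted_map.
apply: sub_sorted => l m /=; apply: contraNneq => /(congr1 letter_inv).
by rewrite !letter_invK => ->; rewrite letter_invK.
Qed.

End FreeGroup.

Record free_group (T : choiceType) := FreeGroup {
  fg_word :> seq (T * bool);
  fg_wordP : reduced fg_word
}.

HB.instance Definition _ (T : choiceType) := [isSub for @fg_word T].
HB.instance Definition _ (T : choiceType) := [Choice of free_group T by <:].

Section FreeGroupTheory.
Context {T : choiceType}.
Implicit Types u v w : free_group T.

Definition fg_one : free_group T := @FreeGroup T [::] isT.
Definition fg_mul u v : free_group T := FreeGroup (reduce_reduced (u ++ v)).
Definition fg_inv u : free_group T := FreeGroup (word_inv_reduced (fg_wordP u)).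
Definition fg_gen (x : T) : free_group T := @FreeGroup T [:: (x, false)] isT.

Lemma fg_eq u v : u = v :> seq _ -> u = v.
Proof. exact: val_inj. Qed.

Lemma fg_word_mul u v : fg_mul u v = foldr push v u :> seq _.
Proof. by rewrite /= /reduce foldr_cat -/(reduce v) reduce_id ?fg_wordP. Qed.

Lemma fg_mulA : associative fg_mul.
Proof.
move=> u v w; apply: fg_eq.
rewrite [LHS]fg_word_mul [in LHS]fg_word_mul [RHS]fg_word_mul /=.
by rewrite foldr_push_reduce ?fg_wordP// foldr_cat.
Qed.

Lemma fg_mul1 : left_id fg_one fg_mul.
Proof. by move=> u; apply: fg_eq; rewrite fg_word_mul. Qed.

Lemma fg_mulr1 : right_id fg_one fg_mul.
Proof. by move=> u; apply: fg_eq; rewrite /= cats0 reduce_id ?fg_wordP. Qed.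

Lemma fg_mulV : left_inverse fg_one fg_inv fg_mul.
Proof.
move=> u; apply: fg_eq; rewrite /= /reduce foldr_cat -/(reduce u).
exact: foldr_push_inv.
Qed.

Lemma fg_mulrV : right_inverse fg_one fg_inv fg_mul.
Proof.
by move=> u; rewrite -[X in fg_mul X](_ : fg_inv (fg_inv u) = u) ?fg_mulV//;
  apply: fg_eq; rewrite /= word_invK.
Qed.

HB.instance Definition _ := isGroup.Build (free_group T)
  fg_mulA fg_mul1 fg_mulr1 fg_mulV fg_mulrV.

Lemma fg_genE (x : T) (e : bool) :
  (if e then (fg_gen x)^-1 else fg_gen x) = [:: (x, e)] :> seq _.
Proof. by case: e. Qed.

Lemma fg_cons l s (Hls : reduced (l :: s)) (Hs : reduced s) :
  FreeGroup Hls = (if l.2 then (fg_gen l.1)^-1 else fg_gen l.1) * FreeGroup Hs.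
Proof.
apply: fg_eq; rewrite fg_word_mul; case: l Hls => x e Hls.
rewrite fg_genE /=; case: s Hls {Hs} => //= m s; rewrite /reduced /=.
by case/andP => /negPf->.
Qed.

Section Lift.
Context {G : groupType} (f : T -> G).

Definition letter_lift (l : T * bool) : G := if l.2 then (f l.1)^-1 else f l.1.
Definition word_lift (s : seq (T * bool)) : G :=
  foldr (fun l x => letter_lift l * x) 1 s.
Definition fg_lift u : G := word_lift u.

Lemma word_lift_reduce s : word_lift (reduce s) = word_lift s.
Proof.
elim: s => //= l s <-; case: (reduce s) => //= m r.
case: eqP => //= ->; rewrite mulgA.
by case: l => x [] /=; rewrite /letter_lift /= (mulVg, mulgV) mul1g.
Qed.

Lemma fg_liftM : {morph fg_lift : u v / u * v}.
Proof.
move=> u v; rewrite /fg_lift /= word_lift_reduce.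
by elim: (fg_word u) => [|l s IHs] /=; rewrite ?mul1g // IHs mulgA.
Qed.

Lemma fg_lift_gen x : fg_lift (fg_gen x) = f x.
Proof. exact: mulg1. Qed.

End Lift.

Theorem fg_universal (G : groupType) (f : T -> G) :
  exists! phi : free_group T -> G,
    {morph phi : u v / u * v} /\ forall x, phi (fg_gen x) = f x.
Proof.
exists (fg_lift f); split=> [|phi [phiM phi_gen]].
  by split; [exact: fg_liftM | exact: fg_lift_gen].
have phi1 : phi 1 = 1 by apply: (mulgI (phi 1)); rewrite -phiM !mulg1.
have phiV u : phi u^-1 = (phi u)^-1.
  by apply: (mulgI (phi u)); rewrite -phiM !mulgV.
apply/funext => -[s Hs]; rewrite /fg_lift /=; elim: s Hs => [|l s IHs] Hs /=.
  by rewrite -phi1; congr phi; apply: fg_eq.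
rewrite (fg_cons Hs (path_sorted Hs)) phiM (IHs (path_sorted Hs)).
by congr (_ * _); rewrite /letter_lift; case: l.2; rewrite ?phiV phi_gen.
Qed.

End FreeGroupTheory.

Section PseudoLength.
Context {R : realType} {G : groupType}.
Local Open Scope ring_scope.

(* Over a general ordered abelian group [L] there is one more axiom, requiring
   certain values to lie in [2L]; it is vacuous over [R]. *)
Record pseudo_length (len : G -> R) : Prop := PseudoLength {
  len_ge0 : forall g, 0 <= len g;
  lenA1 : forall g h, len (g * h * g^-1)%g = len h;
  lenA2 : forall g h,
    len (g * h)%g = len (g * h^-1)%g \/
    Num.max (len (g * h)%g) (len (g * h^-1)%g) <= len g + len h;
  lenA3 : forall g h, 0 < len g -> 0 < len h ->
    (len (g * h)%g = len (g * h^-1)%g /\ len g + len h < len (g * h^-1)%g) \/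
    Num.max (len (g * h)%g) (len (g * h^-1)%g) = len g + len h
}.

Definition purely_hyperbolic (len : G -> R) : Prop :=
  forall g, g <> 1%g -> 0 < len g.

Definition ping_pong_pair (len : G -> R) (g h : G) : Prop :=
  [/\ 0 < len g, 0 < len h &
      `|len g - len h| < Num.min (len (g * h)%g) (len (g * h^-1)%g)].

End PseudoLength.

Definition is_subgroup (G : groupType) (H : set G) : Prop :=
  [/\ H 1, forall x y, H x -> H y -> H (x * y) & forall x, H x -> H x^-1].

Definition generates (G : groupType) (g h : G) : Prop :=
  smallest (@is_subgroup G) [set g; h]%classic = [set: G]%classic.

(* [while n c f x] runs the loop [while c x do x := f x] for at most [n] tests
   of the condition [c]; it is [None] if the loop has not been left by then. *)
Fixpoint while (A : Type) (n : nat) (c : A -> bool) (f : A -> A) (x : A)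
    : option A :=
  if n is n'.+1 then if c x then while n' c f (f x) else Some x else None.

Section Algorithm.
Context {R : realType} {G : groupType}.
Variable len : G -> R.
Local Open Scope ring_scope.

Definition normalize (p : G * G) : G * G :=
  let: (g, h) := if len p.1 < len p.2 then (p.2, p.1) else p in
  if len (g * h)%g < len (g * h^-1)%g then (g, h^-1%g) else (g, h).

Definition loop_condition (p : G * G) : bool :=
  len p.1 - len p.2 == len (p.1 * p.2^-1)%g.

Definition loop_body (p : G * G) : G * G :=
  normalize ((p.1 * p.2^-1)%g, p.2).

Definition final_step (p : G * G) : G * G :=
  if len p.1 - len p.2 < len (p.1 * p.2^-1)%g then p
  else ((p.1 * p.2^-1)%g, p.2).

Definition algorithm1 (a b : G) (n : nat) : option (G * G) :=
  omap final_step (while n loop_condition loop_body (normalize (a, b))).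

End Algorithm.

Notation F2 := (free_group bool).
Definition F2_a : F2 := fg_gen false.
Definition F2_b : F2 := fg_gen true.

(* Main.v *)
Require Import Defs.
From mathcomp Require Import all_boot all_order all_algebra.
From mathcomp Require Import boolp classical_sets reals.
From mathcomp Require Import lra.

(** While the loop runs, |gh| = |g| + |h| and |gh^-1| = |g| - |h|, so that the
    lengths evolve by the subtractive Euclidean algorithm, and the axioms give
    |[g, h]| <= 2|g|. The moves preserve c := |[g, h]|, which is positive since
    [a, b] <> 1; hence max(|g|, |h|) >= c/2 throughout the loop. As soon as
    |h| < c/2, the shorter element is never replaced again, so |g| drops by the
    constant |h| > 0 at each step; until then |g| + |h| drops by at least c/2.
    Either way the loop is left after finitely many steps. *)

Set Implicit Arguments.
Unset Strict Implicit.
Unset Printing Implicit Defensive.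

Import Order.TTheory GRing.Theory Num.Theory.

Local Open Scope ring_scope.

Lemma while_ind (A : Type) (P : A -> Prop) (c : A -> bool) (f : A -> A) n x y :
  (forall z, P z -> P (f z)) -> P x -> while n c f x = Some y ->
  P y /\ ~~ c y.
Proof.
move=> Pf; elim: n x => //= n IHn x Px; case: ifPn => [_|ncx [<-]] //.
by apply: IHn; apply: Pf.
Qed.

(** * Nielsen moves on generating pairs *)

Section GroupPairs.
Context {G : groupType}.
Implicit Types g h : G.

Lemma generatesP g h :
  generates g h <->
  forall H : set G, is_subgroup H -> H g -> H h -> forall x, H x.
Proof.
rewrite /generates; split=> [gen H subH Hg Hh x|gen].
  have : [set: G]%classic x by [].
  by rewrite -gen; apply; split=> // y [] ->.
apply/seteqP; split=> // x _ H [subH gh_H].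
by apply: gen => //; apply: gh_H; [left | right].
Qed.

Lemma generatesC g h : generates g h -> generates h g.
Proof. by move=> /generatesP gen; apply/generatesP => H *; apply: gen. Qed.

Lemma generatesV g h : generates g h -> generates g h^-1%g.
Proof.
move=> /generatesP gen; apply/generatesP => H subH Hg HhV; apply: gen => //.
by case: subH => _ _ HV; rewrite -[h]invgK; apply: HV.
Qed.

Lemma generates_mulVr g h : generates g h -> generates (g * h^-1)%g h.
Proof.
move=> /generatesP gen; apply/generatesP => H subH HghV Hh; apply: gen => //.
by case: subH => _ HM _; rewrite -[g](mulgVK h); apply: HM.
Qed.

End GroupPairs.

Lemma F2_generates : generates F2_a F2_b.
Proof.
apply/generatesP => H [H1 HM HV] Ha Hb -[s Hs].
elim: s Hs => [|l s IHs] Hs.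
  by rewrite [FreeGroup _](_ : _ = 1%g) //; apply: fg_eq.
rewrite (fg_cons Hs (path_sorted Hs)); apply: HM => //.
by case: l {Hs} => -[] [] //=; apply: HV.
Qed.

Lemma F2_comm_neq1 : (F2_a * F2_b * F2_a^-1 * F2_b^-1 <> 1)%g.
(* Both sizes compute: the commutator is a reduced word of four letters, the identity is the empty
   word. *)
Proof. by move=> /(congr1 (fun u : F2 => size u)). Qed.

(** * Lengths of inverses, squares and commutators *)

Section PseudoLengthTheory.
Context {R : realType} {G : groupType} (len : G -> R).
Hypotheses (len_pseudo : pseudo_length len) (len_hyp : purely_hyperbolic len).
Implicit Types (g h : G) (p : G * G).

Definition comm_len p : R := len (p.1 * p.2 * p.1^-1 * p.2^-1)%g.

Lemma len1 : len 1%g = 0.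
Proof.
apply/eqP; rewrite eq_le len_ge0 // andbT leNgt; apply/negP => l1.
(* If |1| > 0, then (A3) at the pair (1, 1) gives |1| > 2|1| or |1| = 2|1|. *)
by have := lenA3 len_pseudo l1 l1; rewrite invg1 mulg1 maxxx => -[[_]|]; lra.
Qed.

Lemma lenV g : len g^-1%g = len g.
Proof.
have le h : len h^-1%g <= len h.
  have := lenA2 len_pseudo 1%g h; rewrite !mul1g len1 add0r ge_max.
  by case=> [->|/andP[]].
by apply/eqP; rewrite eq_le le -{1}[g]invgK le.
Qed.

Lemma lenJ g h : len (g^-1 * h * g)%g = len h.
Proof. by rewrite -{2}[g]invgK lenA1. Qed.

Lemma len_sqr g : len (g * g)%g <= 2 * len g.
Proof.
have := len_ge0 len_pseudo g; have := lenA2 len_pseudo g g.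
by rewrite mulgV len1 ge_max => -[->|/andP[+ _]]; lra.
Qed.

Lemma comm_lenC g h : comm_len (h, g) = comm_len (g, h).
Proof. by rewrite /comm_len /= -lenV !invgM !invgK !mulgA. Qed.

(** Conjugating [h, g] by h^-1 gives [g, h^-1]. *)
Lemma comm_lenV g h : comm_len (g, h^-1%g) = comm_len (g, h).
Proof.
rewrite -(comm_lenC g h) /comm_len /= -(lenJ h (h * _ * _ * _)%g).
by rewrite !invgK !mulgA mulVg mul1g.
Qed.

Lemma comm_len_mulVr g h : comm_len ((g * h^-1)%g, h) = comm_len (g, h).
Proof. by rewrite /comm_len /= invgM invgK !mulgA mulgVK. Qed.

(** If g, h or gh^-1 is trivial, then g and h commute and [g, h] has length 0. *)
Lemma comm_len_gt0 g h :
  0 < comm_len (g, h) -> [/\ 0 < len g, 0 < len h & 0 < len (g * h^-1)%g].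
Proof.
have gt0 x y : 0 < comm_len (x, y) -> 0 < len x.
  move=> c0; apply: len_hyp => x1; move: c0.
  by rewrite /comm_len /= x1 mul1g invg1 mulg1 mulgV len1 ltxx.
move=> c0; split; first exact: gt0 c0.
  by apply: (gt0 h g); rewrite comm_lenC.
by apply: (gt0 _ h); rewrite comm_len_mulVr.
Qed.

(** Normalization only swaps the entries or inverts the second one, so an invariant can be checked
    on these two moves regardless of the length tests. *)
Lemma normalize_ind (P : G * G -> Prop) p :
  (forall g h, P (g, h) -> P (h, g)) ->
  (forall g h, P (g, h) -> P (g, h^-1%g)) ->
  P p -> P (normalize len p).
Proof.
move=> PC PV; case: p => g h; rewrite /normalize /= => Pgh.
by case: ifP => _; case: ifP => _; try apply: PV; try exact: PC.
Qed.

Lemma normalize_len1 p :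
  len (normalize len p).1 = Num.max (len p.1) (len p.2).
Proof.
by case: p => g h; rewrite /normalize /=; case: ltP => _; case: ifP.
Qed.

Lemma normalize_len2 p :
  len (normalize len p).2 = Num.min (len p.1) (len p.2).
Proof.
by case: p => g h; rewrite /normalize /=; case: ltP => _; case: ifP;
  rewrite //= lenV.
Qed.

Definition normalized p : Prop :=
  len p.2 <= len p.1 /\ len (p.1 * p.2^-1)%g <= len (p.1 * p.2)%g.

Lemma normalize_normalized p : normalized (normalize len p).
Proof.
split; first by rewrite normalize_len1 normalize_len2 ge_min le_max lexx.
case: p => g h; rewrite /normalize /=.
by case: ifP => _; case: ltP => //=; rewrite invgK => /ltW.
Qed.

Lemma normalize_comm_len p : comm_len (normalize len p) = comm_len p.
Proof.
apply: (@normalize_ind (fun q => comm_len q = comm_len p)) => // g h <-.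
  exact: comm_lenC.
exact: comm_lenV.
Qed.

Lemma loop_body_comm_len p : comm_len (loop_body len p) = comm_len p.
Proof. by case: p => g h; rewrite normalize_comm_len comm_len_mulVr. Qed.

Lemma normalize_generates p :
  generates p.1 p.2 -> generates (normalize len p).1 (normalize len p).2.
Proof.
apply: (@normalize_ind (fun q => generates q.1 q.2)) => g h.
  exact: generatesC.
exact: generatesV.
Qed.

Lemma loop_condition_len_mul p :
  normalized p -> loop_condition len p -> 0 < comm_len p ->
  len (p.1 * p.2)%g = len p.1 + len p.2.
Proof.
case: p => g h [/= hg hgV] /eqP /= cond /comm_len_gt0[g0 h0 _].
(* The first case of (A3) would make |gh^-1| = |g| - |h| exceed |g| + |h|; in the second,
   normalization makes |gh| the maximum. *)
case: (lenA3 len_pseudo g0 h0) => [[_]|]; last by rewrite (max_l hgV).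
by rewrite -cond; lra.
Qed.

Lemma loop_condition_comm_len p :
  normalized p -> loop_condition len p -> 0 < comm_len p ->
  comm_len p <= 2 * len p.1.
Proof.
case: p => g h /= np cond c0; have ghE := loop_condition_len_mul np cond c0.
case: np cond ghE => /= hg _ /eqP /= cond ghE.
(* [g, h] is the product of g and h g^-1 h^-1, both of length |g|. If it is
   longer than 2|g|, (A2) gives it the length of (gh)(gh^-1), and (A2) again
   bounds the latter by |gh| + |gh^-1| = 2|g| or by |h^2|. *)
have := lenA2 len_pseudo g (h * g^-1 * h^-1)%g.
rewrite lenA1 // lenV ge_max /comm_len /= !invgM !invgK !mulgA.
case=> [->|/andP[+ _]]; last by lra.
have := lenA2 len_pseudo (g * h)%g (g * h^-1)%g.
rewrite invgM invgK ge_max !mulgA => -[->|/andP[+ _]]; last first.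
  by rewrite ghE -cond; lra.
by rewrite -(mulgA g h h) lenA1 //; have := len_sqr h; lra.
Qed.

(** Here [n] bounds how often the constant |h| can still be subtracted from |g|. *)
Lemma while_loop_terminates_small n p :
  normalized p -> 0 < comm_len p -> 2 * len p.2 < comm_len p ->
  len p.1 < n%:R * len p.2 ->
  exists m, isSome (while m (loop_condition len) (loop_body len) p).
Proof.
elim: n p => [|n IHn] p np c0 hc gn.
  by have := len_ge0 len_pseudo p.1; lra.
have [cond|ncond] := boolP (loop_condition len p); last first.
  by exists 1%N; rewrite /= (negPf ncond).
set q := loop_body len p.
have nq : normalized q by exact: normalize_normalized.
have cq : comm_len q = comm_len p by exact: loop_body_comm_len.
have [condq|ncondq] := boolP (loop_condition len q); last first.
  by exists 2%N; rewrite /= cond -/q (negPf ncondq).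
suff [m qm] : exists m, isSome (while m (loop_condition len) (loop_body len) q).
  by exists m.+1; rewrite /= cond.
(* As [q] also meets the loop condition, c <= 2 max(|g| - |h|, |h|) for p = (g, h). Since 2|h| < c,
   the maximum is |g| - |h|, so normalization does not swap. *)
have := loop_condition_comm_len nq condq; rewrite cq => /(_ c0).
rewrite normalize_len1 /= -(eqP cond) => cmax.
have q2E : len q.2 = len p.2.
  rewrite normalize_len2 /= -(eqP cond) min_r //.
  by case: (leP (len p.1 - len p.2) (len p.2)) cmax; lra.
have q1E : len q.1 = len p.1 - len p.2.
  rewrite normalize_len1 /= -(eqP cond) max_l //.
  by case: (leP (len p.1 - len p.2) (len p.2)) cmax; lra.
apply: IHn; rewrite ?cq ?q2E ?q1E //.
by move: gn; rewrite -natr1; lra.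
Qed.

Lemma while_loop_terminates p :
  normalized p -> 0 < comm_len p ->
  exists m, isSome (while m (loop_condition len) (loop_body len) p).
Proof.
have arch (x y : R) : 0 < y -> exists n, x < n%:R * y.
  move=> y0; exists (Num.bound `|x / y|); rewrite -ltr_pdivrMr //.
  exact: le_lt_trans (ler_norm _) (archi_boundP (normr_ge0 _)).
move=> np c0; have [n] := arch (2 * (len p.1 + len p.2)) _ c0.
elim: n p np c0 => [|n IHn] p np c0 ltn.
  by have := len_ge0 len_pseudo p.1; have := len_ge0 len_pseudo p.2; lra.
have [hc|ch] := ltP (2 * len p.2) (comm_len p).
  have [|k ltk] := arch (len p.1) (len p.2).
    by case: (p) c0 => g h /comm_len_gt0[].
  exact: while_loop_terminates_small hc ltk.
have [cond|ncond] := boolP (loop_condition len p); last first.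
  by exists 1%N; rewrite /= (negPf ncond).
have cq := loop_body_comm_len p.
have [||m qm] := IHn (loop_body len p) (normalize_normalized _).
- by rewrite cq.
(* The new lengths |g| - |h| and |h| add up to |g|, so twice the sum drops by 2|h| >= c. *)
- rewrite cq normalize_len1 normalize_len2 addr_max_min /= -(eqP cond).
  by move: ltn; rewrite -natr1; lra.
by exists m.+1; rewrite /= cond.
Qed.

(** * Correctness of the output *)

Lemma final_step_ping_pong p :
  normalized p -> 0 < comm_len p -> ~~ loop_condition len p ->
  ping_pong_pair len (final_step len p).1 (final_step len p).2.
Proof.
case: p => g h [/= hg hgV] /comm_len_gt0[g0 h0 gh0].
rewrite /loop_condition /final_step /= => ncond.
case: ltgtP ncond => //= lt _.
  by split=> //; rewrite lt_min ger0_norm ?subr_ge0 // lt (lt_le_trans lt).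
(* Since |(gh^-1)h| = |g| > |gh^-1| + |h|, (A3) forces |gh^-2| = |g|. *)
have := lenA3 len_pseudo gh0 h0; rewrite mulgVK => -[[gE ghlt]|gE].
  by split=> //; rewrite /= mulgVK -gE minxx ltr_norml; lra.
have : len g <= Num.max (len g) (len (g / h / h)%g) by rewrite le_max lexx.
by rewrite gE; lra.
Qed.

End PseudoLengthTheory.

Theorem proposition4p4 (R : realType) (len : F2 -> R)
    (len_pseudo : pseudo_length len) (len_hyp : purely_hyperbolic len) :
  (exists n : nat, isSome (algorithm1 len F2_a F2_b n)) /\
  (forall (n : nat) (g h : F2),
      algorithm1 len F2_a F2_b n = Some (g, h) ->
      ping_pong_pair len g h /\ generates g h).
Proof.
have c0 : 0 < comm_len len (normalize len (F2_a, F2_b)).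
  by rewrite normalize_comm_len //; apply: len_hyp; exact: F2_comm_neq1.
split=> [|n g h].
  have np := normalize_normalized len_pseudo (F2_a, F2_b).
  have [n loop_n] := while_loop_terminates len_pseudo len_hyp np c0.
  by exists n; move: loop_n; rewrite /algorithm1; case: while.
rewrite /algorithm1.
case E: while => [p|] //= [fp].
(* The loop invariant: a pass is a composite of Nielsen moves, which keep c and generation, and it
   ends by normalizing. *)
pose P p := [/\ normalized len p, 0 < comm_len len p & generates p.1 p.2].
have [| |[np cp gp] ncond] := while_ind (P := P) _ _ E.
- move=> q [_ cq gq]; split; first exact: normalize_normalized.
    by rewrite loop_body_comm_len.
  by apply: normalize_generates; exact: generates_mulVr.
- split=> //; first exact: normalize_normalized.
  by apply: normalize_generates; exact: F2_generates.
have := final_step_ping_pong len_pseudo len_hyp np cp ncond; rewrite fp.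
(* The final step changes nothing or is one more Nielsen move. *)
split=> //; move: fp; rewrite /final_step; case: ifP => _ fp.
  by move: gp; rewrite fp.
by case: fp => <- <-; exact: generates_mulVr.
Qed.
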